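(* Let $v:\mathbb{R}^n\to\mathbb{R}^n$ be a unit Lipschitz vector field with Lipschitz constant $K>0$, and let $0<T<1/K$. For all $|s|\le T$ the maps $S_s:\mathbb{R}^n\to\mathbb{R}^n$, $S_s(X)=X+s\,v(X)$, are one to one and onto. Furthermore there exist constants $c_n,C_n>0$ depending only on $n$, $K$ and $T$ such that for all $|s|\le T$ and all measurable sets $A\subset\mathbb{R}^n$, $$c_n\,\mu_n(S_s(A))\le\mu_n(A)\le C_n\,\mu_n(S_s(A)).$$
   Context: A unit Lipschitz vector field on $\mathbb{R}^n$ with Lipschitz constant $K$ is a map $v:\mathbb{R}^n\to\mathbb{R}^n$ with $\|v(X)\|_2=1$ for all $X$ and $\|v(X)-v(Y)\|\le K\|X-Y\|$ for all $X,Y$. $\mu_n$ denotes Lebesgue measure on $\mathbb{R}^n$. *)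

(* Defs.v *)
From HB Require Import structures.
From mathcomp Require Import all_boot all_order all_algebra.
From mathcomp Require Import all_classical all_reals all_analysis.

Set Implicit Arguments.
Unset Strict Implicit.
Unset Printing Implicit Defensive.

Import Order.TTheory GRing.Theory Num.Theory.
Import numFieldNormedType.Exports.

Local Open Scope classical_set_scope.
Local Open Scope ring_scope.

(* The library norm `|x| on 'rV[R]_n is the sup norm, hence a separate
   Euclidean norm. *)
Definition norm2 (R : realType) (n : nat) (x : 'rV[R]_n) : R :=
  Num.sqrt (\sum_(i < n) x 0 i ^+ 2).

Definition unit_lipschitz_field (R : realType) (n : nat) (K : R)
    (v : 'rV[R]_n -> 'rV[R]_n) : Prop :=
  (forall X, norm2 (v X) = 1) /\
  (forall X Y, norm2 (v X - v Y) <= K * norm2 (X - Y)).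

Definition shift_along (R : realType) (n : nat)
    (v : 'rV[R]_n -> 'rV[R]_n) (s : R) (X : 'rV[R]_n) : 'rV[R]_n :=
  X + s *: v X.

(* Lebesgue measure on R^n: Caratheodory restriction of the outer measure
   obtained from countable covers by half-open boxes.  The library provides
   Lebesgue measure in dimension one only. *)
Section lebesgue_rV.
Context (R : realType) (n : nat).
Implicit Types (ab : 'rV[R]_n * 'rV[R]_n) (A : set 'rV[R]_n).

Definition box ab : set 'rV[R]_n :=
  [set x | forall i, x 0 i \in `]ab.1 0 i, ab.2 0 i]].

Definition box_volume ab : R := \prod_(i < n) Num.max 0 (ab.2 0 i - ab.1 0 i).

(* Finite and empty families are allowed; the empty one gives measure 0 to
   set0 when n = 0, where every box has volume 1. *)
Definition box_covers A : set (set ('rV[R]_n * 'rV[R]_n)) :=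
  [set C | countable C /\ A `<=` \bigcup_(ab in C) box ab].

Definition lebesgue_outer A : \bar R :=
  ereal_inf [set (\esum_(ab in C) (box_volume ab)%:E)%E | C in box_covers A].

Lemma box_volume_ge0 ab : 0 <= box_volume ab.
Proof. by apply: prodr_ge0 => i _; rewrite le_max lexx. Qed.

Local Open Scope ereal_scope.

Let esum_volume_ge0 (C : set ('rV[R]_n * 'rV[R]_n)) :
  0 <= \esum_(ab in C) (box_volume ab)%:E.
Proof. by apply: esum_ge0 => ab _; rewrite lee_fin box_volume_ge0. Qed.

Let le_esum_volume (C D : set ('rV[R]_n * 'rV[R]_n)) : C `<=` D ->
  \esum_(ab in C) (box_volume ab)%:E <= \esum_(ab in D) (box_volume ab)%:E.
Proof.
move=> CD; rewrite [leLHS]esum_mkcond [leRHS]esum_mkcond; apply: le_esum => x _.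
case: ifPn => [/set_mem/CD/mem_set -> //|_].
by case: ifPn => // _; rewrite lee_fin box_volume_ge0.
Qed.

Lemma lebesgue_outer0 : lebesgue_outer set0 = 0.
Proof.
apply/eqP; rewrite eq_le; apply/andP; split.
  apply: ereal_inf_lbound; exists set0; last by rewrite esum_set0.
  by split; [exact: countable0|exact: sub0set].
by apply: le_ereal_inf_tmp => _ [C _ <-].
Qed.

Lemma lebesgue_outer_ge0 A : 0 <= lebesgue_outer A.
Proof. by apply: le_ereal_inf_tmp => _ [C _ <-]. Qed.

Lemma le_lebesgue_outer : {homo lebesgue_outer : A B / A `<=` B >-> A <= B}.
Proof.
move=> A B AB; apply/ereal_inf_le_tmp => _ [C [cC BC] <-].
by exists C => //; split=> //; exact: subset_trans BC.
Qed.

Lemma lebesgue_outer_sigma_subadditive : sigma_subadditive lebesgue_outer.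
Proof.
move=> A; have [[i ioo]|] := pselect (exists i, lebesgue_outer (A i) = +oo).
  rewrite (eseries_pinfty _ _ ioo) ?leey// => k _.
  by rewrite -ltNye (lt_le_trans _ (lebesgue_outer_ge0 _)).
rewrite -forallNE => Aoo; apply/lee_addgt0Pr => e e0.
rewrite (le_trans _ (epsilon_trick _ _ (ltW e0)))//; last first.
  by move=> k; exact: lebesgue_outer_ge0.
pose P k C := box_covers (A k) C /\ \esum_(ab in C) (box_volume ab)%:E <=
  lebesgue_outer (A k) + (e / (2 ^ k.+1)%:R)%:E.
have [C PC] : {C & forall k, P k (C k)}.
  apply: (@choice _ _ P) => k.
  have fA : lebesgue_outer (A k) \is a fin_num.
    by rewrite ge0_fin_numE ?lebesgue_outer_ge0// ltey; apply/eqP/Aoo.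
  have ek : (0 < e / (2 ^ k.+1)%:R)%R by rewrite divr_gt0// ltr0n expn_gt0.
  have [_ [C AC <-] lC] := lb_ereal_inf_adherent ek fA.
  by exists C; split=> //; exact/ltW.
apply: (@le_trans _ _ (\esum_(ab in \bigcup_k C k) (box_volume ab)%:E)).
  apply: ereal_inf_lbound; exists (\bigcup_k C k) => //; split.
    by apply: bigcup_countable => // k _; exact: (PC k).1.1.
  move=> x [k _ /(PC k).1.2 [ab Cab abx]].
  by exists ab => //; exists k.
rewrite seqDU_bigcup_eq nneseries_sum_bigcup; last 2 first.
- exact: trivIset_seqDU.
- by move=> ab; rewrite lee_fin box_volume_ge0.
apply: lee_nneseries => [k _ _|k _]; first exact: esum_volume_ge0.
by apply: le_trans (PC k).2; apply: le_esum_volume; exact: subset_seqDU.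
Qed.

HB.instance Definition _ := isOuterMeasure.Build R 'rV[R]_n lebesgue_outer
  lebesgue_outer0 lebesgue_outer_ge0 le_lebesgue_outer
  lebesgue_outer_sigma_subadditive.

Definition lebesgue_rV : set (caratheodory_type lebesgue_outer) -> \bar R :=
  lebesgue_outer.

HB.instance Definition _ := isMeasure.Build _ _ _ lebesgue_rV
  (caratheodory_measure0 lebesgue_outer)
  (@caratheodory_measure_ge0 _ _ lebesgue_outer)
  (@caratheodory_measure_sigma_additive _ _ lebesgue_outer).

End lebesgue_rV.

Arguments lebesgue_outer : clear implicits.
Arguments lebesgue_rV : clear implicits.

Definition lebesgue_measurable (R : realType) (n : nat) (A : set 'rV[R]_n) :
  Prop := (lebesgue_outer R n).-cara.-measurable A.

(* Main.v *)
Require Import Defs.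
From mathcomp Require Import all_boot all_order all_algebra.
From mathcomp Require Import all_classical all_reals all_analysis.
From mathcomp Require Import lra ring.

(* As |s|K <= TK < 1, the map S_s is bi-Lipschitz with constants 1 + TK and
   1 / (1 - TK), and onto because X |-> Y - s v(X) is a contraction.  A Lipschitz
   map multiplies outer Lebesgue measure by at most a constant: cut a box into
   cubes of side at most its shortest edge and put the image of each cube in a
   cube.  A measurable set of finite measure is a countable intersection of
   countable unions of boxes minus a null set; a bi-Lipschitz bijection preserves
   both the Borel sets and the null sets, hence measurability. *)

Set Implicit Arguments.
Unset Strict Implicit.
Unset Printing Implicit Defensive.

Import Order.TTheory GRing.Theory Num.Theory.
Import numFieldNormedType.Exports.

Local Open Scope classical_set_scope.
Local Open Scope ring_scope.

(** * The Euclidean norm and its contractions *)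

Lemma norm2_ge0 (R : realType) (n : nat) (x : 'rV[R]_n) : 0 <= norm2 x.
Proof. exact: sqrtr_ge0. Qed.

Lemma sqr_norm2 (R : realType) (n : nat) (x : 'rV[R]_n) :
  norm2 x ^+ 2 = \sum_(i < n) x 0 i ^+ 2.
Proof. by rewrite sqr_sqrtr// sumr_ge0// => i _; rewrite sqr_ge0. Qed.

Lemma norm2_coord (R : realType) (n : nat) (x : 'rV[R]_n) i :
  `|x 0 i| <= norm2 x.
Proof.
rewrite -[leRHS]ger0_norm ?norm2_ge0// -ler_sqr ?qualifE//= !real_normK ?num_real//.
by rewrite sqr_norm2 (bigD1 i)//= lerDl sumr_ge0// => j _; rewrite sqr_ge0.
Qed.

Lemma norm2_eq0 (R : realType) (n : nat) (x : 'rV[R]_n) : norm2 x = 0 -> x = 0.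
Proof.
move=> x0; apply/rowP => i; rewrite [RHS]mxE; apply/eqP.
by rewrite -normr_le0 -x0 norm2_coord.
Qed.

Lemma norm20 (R : realType) (n : nat) : norm2 (0 : 'rV[R]_n) = 0.
Proof. by rewrite /norm2 big1 ?sqrtr0// => i _; rewrite mxE expr0n. Qed.

Lemma norm2Z (R : realType) (n : nat) (a : R) (x : 'rV[R]_n) :
  norm2 (a *: x) = `|a| * norm2 x.
Proof.
rewrite /norm2 -sqrtr_sqr -sqrtrM ?sqr_ge0// mulr_sumr; congr Num.sqrt.
by apply: eq_bigr => i _; rewrite mxE exprMn.
Qed.

Lemma norm2N (R : realType) (n : nat) (x : 'rV[R]_n) : norm2 (- x) = norm2 x.
Proof. by rewrite -scaleN1r norm2Z normrN normr1 mul1r. Qed.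

Lemma ler_norm2D (R : realType) (n : nat) (x y : 'rV[R]_n) :
  norm2 (x + y) <= norm2 x + norm2 y.
Proof.
have [/norm2_eq0->|x0] := eqVneq (norm2 x) 0; first by rewrite add0r norm20 add0r.
have [/norm2_eq0->|y0] := eqVneq (norm2 y) 0; first by rewrite addr0 norm20 addr0.
have {}x0 : 0 < norm2 x by rewrite lt0r x0 norm2_ge0.
have {}y0 : 0 < norm2 y by rewrite lt0r y0 norm2_ge0.
rewrite -ler_sqr ?qualifE/= ?addr_ge0 ?norm2_ge0// sqr_norm2.
set p := norm2 x in x0 *; set q := norm2 y in y0 *.
(* The squared entries sum to [p ^+ 2] and [q ^+ 2], so the bound also becomes a sum over
   coordinates and a termwise comparison suffices. *)
have -> : (p + q) ^+ 2 =
    \sum_(i < n) (p + q) * (x 0 i ^+ 2 / p + y 0 i ^+ 2 / q).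
  rewrite -mulr_sumr big_split/= -!mulr_suml -!sqr_norm2 -/p -/q.
  by field; rewrite !gt_eqF.
(* convexity of the square, with weights [p / (p + q)] and [q / (p + q)] *)
apply: ler_sum => i _; rewrite mxE -subr_ge0.
have -> : (p + q) * (x 0 i ^+ 2 / p + y 0 i ^+ 2 / q) - (x 0 i + y 0 i) ^+ 2 =
    (q * x 0 i - p * y 0 i) ^+ 2 / (p * q).
  by field; rewrite !gt_eqF.
by rewrite divr_ge0 ?sqr_ge0// mulr_ge0 ?ltW.
Qed.

(** The sharp factor is the square root of [n]; [n.+1] avoids the root and stays positive when [n]
    is 0. *)
Lemma norm2_le_coord (R : realType) (n : nat) (x : 'rV[R]_n) (r : R) :
  0 <= r -> (forall i, `|x 0 i| <= r) -> norm2 x <= n.+1%:R * r.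
Proof.
move=> r0 xr; rewrite -ler_sqr ?qualifE/= ?norm2_ge0 ?mulr_ge0// sqr_norm2.
apply: (@le_trans _ _ (n%:R * r ^+ 2)).
  rewrite mulr_natl -[X in _ *+ X]card_ord -sumr_const ler_sum// => i _.
  by rewrite -real_normK ?num_real// ler_sqr ?qualifE//=.
rewrite exprMn ler_wpM2r ?sqr_ge0// -natrX ler_nat.
by rewrite (leq_trans (leqnSn n))// -mulnn leq_pmulr.
Qed.

(** Banach's theorem for the Euclidean norm. Successive iterates differ by at most a geometric term,
    so each coordinate converges by comparison, and the limit is assembled coordinatewise. *)
Lemma norm2_fixpoint (R : realType) (n : nat) (q : R)
    (F : 'rV[R]_n -> 'rV[R]_n) : 0 <= q -> q < 1 ->
  (forall X Y, norm2 (F X - F Y) <= q * norm2 (X - Y)) -> exists X, F X = X.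
Proof.
move=> q0 q1 Fq; pose x k := iter k F 0.
have xS k : norm2 (x k.+1 - x k) <= norm2 (x 1%N - x 0%N) * q ^+ k.
  elim: k => [|k IH]; first by rewrite expr0 mulr1.
  by rewrite (le_trans (Fq _ _))// exprS mulrCA ler_wpM2l.
have cx i : cvgn (fun k => x k 0 i).
  pose d k := x k.+1 0 i - x k 0 i.
  have cd : cvgn (series d).
    apply: normed_cvg; apply: (@series_le_cvg _ _ (geometric (norm2 (x 1%N - x 0%N)) q)).
    - by move=> k /=; rewrite normr_ge0.
    - by move=> k /=; rewrite mulr_ge0 ?norm2_ge0 ?exprn_ge0.
    - move=> k; apply: (le_trans _ (xS k)).
      by have := norm2_coord (x k.+1 - x k) i; rewrite !mxE.
    - by apply: is_cvg_geometric_series; rewrite ger0_norm.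
  have -> : (fun k => x k 0 i) = (fun k => x 0%N 0 i + series d k).
    apply/funext => k; rewrite /series/= /d (telescope_sumr (fun k => x k 0 i))//.
    by rewrite addrC subrK.
  by apply: is_cvgD => //; exact: is_cvg_cst.
pose l : 'rV[R]_n := \row_i limn (fun k => x k 0 i).
exists l; apply/eqP; rewrite -subr_eq0; apply/eqP/norm2_eq0/le_anti.
rewrite norm2_ge0 andbT; apply/ler_addgt0Pl => e e0; rewrite addr0.
pose e' := e / 2 / n.+1%:R.
have e'0 : 0 < e' by rewrite !divr_gt0.
have near_l : \forall k \near \oo, forall i, `|l 0 i - x k 0 i| < e'.
  apply: filter_forall => i; rewrite mxE.
  by have /cvgrPdist_lt/(_ _ e'0) := cx i.
have near_norm k : (forall i, `|l 0 i - x k 0 i| < e') -> norm2 (l - x k) <= e / 2.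
  move=> h; have -> : e / 2 = n.+1%:R * e' by rewrite /e'; field.
  apply: norm2_le_coord => [|i]; first exact: ltW.
  by have := h i; rewrite !mxE => /ltW.
have [N _ hN] := near_l.
(* [x N.+1] is [F (x N)], so its distance to [F l] is at most that of [x N] to [l], hence at most
   [e / 2]; its distance to [l] takes the other half of [e]. *)
rewrite -(subrKA (x N.+1)) (splitr e) (le_trans (ler_norm2D _ _))// lerD//.
  apply: (le_trans (Fq _ (x N))).
  by rewrite (le_trans (ler_piMl _ (ltW q1))) ?norm2_ge0// near_norm//; apply: hN => /=.
by rewrite -norm2N opprB near_norm//; apply: hN => /=.
Qed.

(** * Bi-Lipschitz bounds and bijectivity of the shift *)

Section shift.
Context (R : realType) (n : nat) (K T : R) (v : 'rV[R]_n -> 'rV[R]_n) (s : R).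
Context (K0 : 0 < K) (TK : T < 1 / K) (vK : unit_lipschitz_field K v)
  (sT : `|s| <= T).

Let TK1 : T * K < 1. Proof. by rewrite -ltr_pdivlMr. Qed.

Let svK X Y : norm2 (s *: v X - s *: v Y) <= T * K * norm2 (X - Y).
Proof.
rewrite -scalerBr norm2Z -mulrA ler_pM ?norm2_ge0//.
by have [_] := vK; exact.
Qed.

Lemma shift_along_lipschitz X Y :
  norm2 (shift_along v s X - shift_along v s Y) <= (1 + T * K) * norm2 (X - Y).
Proof.
rewrite /shift_along opprD addrACA mulrDl mul1r.
by rewrite (le_trans (ler_norm2D _ _))// lerD2l.
Qed.

(** Reverse triangle inequality. As [T * K < 1], it yields both injectivity and the Lipschitz
    constant of the inverse. *)
Lemma shift_along_expansive X Y :
  (1 - T * K) * norm2 (X - Y) <= norm2 (shift_along v s X - shift_along v s Y).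
Proof.
rewrite mulrBl mul1r lerBlDr /shift_along opprD addrACA.
rewrite -[X in norm2 X <= _](addrK (s *: v X - s *: v Y)).
by rewrite (le_trans (ler_norm2D _ _))// norm2N lerD2l.
Qed.

Lemma shift_along_bij : set_bij setT setT (shift_along v s).
Proof.
split=> // [X Y _ _ XY|Y _].
  have := shift_along_expansive X Y; rewrite XY subrr norm20.
  rewrite pmulr_rle0 ?subr_gt0// => XY0.
  by apply/eqP; rewrite -subr_eq0; apply/eqP/norm2_eq0/le_anti; rewrite XY0 norm2_ge0.
have TK0 : 0 <= T * K by rewrite mulr_ge0 ?(le_trans (normr_ge0 _) sT) ?ltW.
have [|X XE] := @norm2_fixpoint R n (T * K) (fun X => Y - s *: v X) TK0 TK1.
  by move=> A B; rewrite opprB addrC subrKA -norm2N opprB.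
by exists X => //; rewrite /shift_along -{1}XE subrK.
Qed.

End shift.

(** * The sup norm and countable index sets *)

Lemma rV_norm_le (R : realType) (n : nat) (x : 'rV[R]_n) (r : R) :
  0 <= r -> (forall i, `|x 0 i| <= r) -> `|x| <= r.
Proof.
move=> r0 xr; rewrite [leLHS]/Num.Def.normr/= mx_normrE bigmax_le//= => -[i j] _ /=.
by rewrite ord1.
Qed.

Lemma rV_norm_coord (R : realType) (n : nat) (x : 'rV[R]_n) i : `|x 0 i| <= `|x|.
Proof.
rewrite [leRHS]/Num.Def.normr/= mx_normrE.
exact: (le_bigmax _ (fun ij : 'I_1 * 'I_n => `|x ij.1 ij.2|) (0, i)).
Qed.

(** Covers are sets of boxes, while countable unions and sums run along [nat]. Indexing by a subset
    [D] of [nat] includes finite and empty covers. *)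
Lemma countable_set_bij (I : pointedType) (C : set I) : countable C ->
  exists (D : set nat) (h : nat -> I), set_bij D C h.
Proof.
move=> /countable_bijP[D]; rewrite card_eq_sym => /card_set_bijP[h hb].
by exists D, h.
Qed.

Lemma outer_measure_esum (R : realType) (T : Type)
    (mu : {outer_measure set T -> \bar R}) (I : pointedType) (C : set I)
    (F : I -> set T) : countable C ->
  (mu (\bigcup_(i in C) F i) <= \esum_(i in C) mu (F i))%E.
Proof.
move=> /countable_set_bij[D [h hb]].
rewrite (reindex_esum _ _ _ _ hb); have [hf _ hs] := hb.
rewrite (reindex_bigcup _ _ _ _ hf hs) bigcup_mkcond esum_mkcond.
apply: (le_trans (outer_measure_sigma_subadditive mu _)).
rewrite nneseries_esumT; last by move=> k; exact: outer_measure_ge0.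
by apply: le_esum => k _; case: ifP => // _; rewrite outer_measure0.
Qed.

Lemma countable_bigcup_measurable d (T : sigmaRingType d) (I : pointedType)
    (C : set I) (F : I -> set T) : countable C ->
  (forall i, C i -> measurable (F i)) -> measurable (\bigcup_(i in C) F i).
Proof.
move=> /countable_set_bij[D [h [hf _ hs]]] mF.
by rewrite (reindex_bigcup _ _ _ _ hf hs); apply: bigcup_measurable => k /hf/mF.
Qed.

Lemma outer_measure_fintype (R : realType) (T : Type)
    (mu : {outer_measure set T -> \bar R}) (I : finType) (F : I -> set T) :
  (mu (\bigcup_i F i) <= \sum_i mu (F i))%E.
Proof.
apply: (@le_trans _ _ (mu (\big[setU/set0]_i F i))).
  apply: le_outer_measure => x [i _ Fx].
  by rewrite (bigD1 i)//=; left.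
elim/big_ind2 : _ => [|A a B b Aa Bb|//]; first by rewrite outer_measure0.
by rewrite (le_trans (outer_measureU2 _ _ _))// leeD.
Qed.

(** * Outer measure of Lipschitz images *)

Lemma lebesgue_outer_box (R : realType) (n : nat) (ab : 'rV[R]_n * 'rV[R]_n) :
  (lebesgue_outer R n (box ab) <= (box_volume ab)%:E)%E.
Proof.
apply: ereal_inf_lbound; exists [set ab].
  by split; [exact: countable1|move=> x; exists ab].
by rewrite esum_set1// lee_fin box_volume_ge0.
Qed.

Lemma sum_if_lt (R : realType) (M N : nat) (c : R) : (N <= M)%N ->
  \sum_(j < M) (if (j < N)%N then c else 0) = N%:R * c.
Proof.
move=> NM; rewrite -big_mkcond -(big_ord_widen M (fun=> c))//.
by rewrite sumr_const card_ord mulr_natl.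
Qed.

(** With mesh [h], the image of a cell fits in a cube of side [4 * L * h], and the [N i] cells along
    edge [i] have total length at most twice that edge. Each coordinate thus contributes a factor
    [8 * L]. *)
Lemma lebesgue_outer_image_box (R : realType) (n : nat) (L : R)
    (f : 'rV[R]_n -> 'rV[R]_n) (ab : 'rV[R]_n * 'rV[R]_n) : 0 < L ->
  (forall x y, `|f x - f y| <= L * `|x - y|) ->
  (lebesgue_outer R n (f @` box ab) <= ((8 * L) ^+ n * box_volume ab)%:E)%E.
Proof.
move=> L0 fL; pose d i := ab.2 0 i - ab.1 0 i.
have [[i di]|d_gt0] := pselect (exists i, d i <= 0).
  rewrite (_ : box ab = set0) ?image_set0 ?lebesgue_outer0 ?lee_fin.
    by rewrite mulr_ge0 ?box_volume_ge0// exprn_ge0// mulr_ge0// ltW.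
  rewrite -subset0 => x /(_ i); rewrite in_itv/= => /andP[ax xb].
  by move: di; rewrite subr_le0 leNgt (lt_le_trans ax xb).
have {}d_gt0 i : 0 < d i by rewrite ltNge; apply/negP => di; apply: d_gt0; exists i.
(* The cap [1] is also the value for [n = 0], so [h] is positive in every case. *)
pose h := \big[Num.min/1]_(i < n) d i.
have h0 : 0 < h by apply/lt_bigmin.
have hd i : h <= d i by exact: bigmin_le.
(* The successor makes room for the closed right end, where the cell index equals the truncated
   quotient. *)
pose N i := (Num.trunc (d i / h)).+1.
have Nd i : (N i)%:R * h <= 2 * d i.
  have : (Num.trunc (d i / h))%:R * h <= d i.
    by rewrite -ler_pdivlMr// truncn_le divr_ge0// ltW.
  rewrite /N -[(_ (d i / h)).+1%:R]natr1; have := hd i; lra.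
pose M := \max_(i < n) N i.
have NM i : (N i <= M)%N by exact: leq_bigmax.
pose t (x : 'rV[R]_n) i := Num.trunc ((x 0 i - ab.1 0 i) / h).
pose piece (j : {ffun 'I_n -> 'I_M}) := [set x | box ab x /\ forall i, t x i = j i].
(* An empty cell gets the default [0]; the cover below only uses cells that contain a point. *)
pose p j := xget (0 : 'rV[R]_n) (piece j).
(* The side of the cube is [0] when [j] lies outside the grid, so that the sum
   of the volumes factors as a product of sums over the coordinates. *)
pose lo j := \row_i (f (p j) 0 i - 2 * L * h).
pose hi (j : {ffun 'I_n -> 'I_M}) := \row_i (if (j i < N i)%N then f (p j) 0 i + 2 * L * h else lo j 0 i).
have xa x i : box ab x -> 0 <= x 0 i - ab.1 0 i <= d i.
  by move=> /(_ i); rewrite in_itv/= => /andP[ax xb]; rewrite subr_ge0 ltW// lerD2r.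
have t_lt x i : box ab x -> (t x i < N i)%N.
  by move=> /(xa _ i)/andP[x0 xd]; rewrite ltnS le_truncn// ler_pM2r ?invr_gt0.
have t_itv x i : box ab x ->
    (t x i)%:R * h <= x 0 i - ab.1 0 i <= ((t x i)%:R + 1) * h.
  move=> /(xa _ i)/andP[x0 xd].
  have /truncn_itv/andP[] : 0 <= (x 0 i - ab.1 0 i) / h by rewrite divr_ge0// ltW.
  by rewrite ler_pdivlMr// => ->; rewrite ltr_pdivrMr// -natr1 => /ltW.
have piece_dist j x y : piece j x -> piece j y -> `|x - y| <= h.
  move=> [bx xj] [by_ yj]; apply: rV_norm_le => [|i]; first exact: ltW.
  have := t_itv _ i bx; have := t_itv _ i by_; rewrite xj yj !mxE !mulrDl mul1r.
  by rewrite ler_norml => /andP[? ?] /andP[? ?]; apply/andP; split; lra.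
have cover : f @` box ab `<=` \bigcup_j box (lo j, hi j).
  move=> _ [x bx <-].
  have tM i : (t x i < M)%N by exact: leq_trans (t_lt x i bx) (NM i).
  pose j : {ffun 'I_n -> 'I_M} := [ffun i => Ordinal (tM i)].
  have jx : piece j x by split=> // i; rewrite ffunE.
  have jp : piece j (p j) by apply: xgetPex; exists x.
  exists j => // i; rewrite /= in_itv/= !mxE (ffunE _ i)/= t_lt//.
  have := le_trans (rV_norm_coord _ i) (le_trans (fL x (p j))
    (ler_wpM2l (ltW L0) (piece_dist _ _ _ jx jp))).
  (* The image point is within [L * h] of the centre; the half-side [2 * L * h] leaves the strict
     inequality needed at the open left end. *)
  have : 0 < L * h by rewrite mulr_gt0.
  by rewrite !mxE ler_norml => Lh /andP[? ?]; apply/andP; split; lra.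
apply: (le_trans (le_outer_measure _ _ _ cover)).
apply: (le_trans (outer_measure_fintype _ _)).
apply: (@le_trans _ _ (\sum_j (box_volume (lo j, hi j))%:E)%E).
  by apply: lee_sum => j _; exact: lebesgue_outer_box.
rewrite sumEFin lee_fin.
rewrite (eq_bigr (fun j : {ffun 'I_n -> 'I_M} =>
    \prod_(i < n) (if (j i < N i)%N then 4 * L * h else 0))); last first.
  move=> j _; apply: eq_bigr => i _; rewrite !mxE/=; case: ifP => _.
    rewrite max_r; first by ring.
    have : 0 < L * h by rewrite mulr_gt0.
    by move=> ?; lra.
  by rewrite subrr maxxx.
rewrite -(bigA_distr_bigA (fun i (j : 'I_M) => if (j < N i)%N then 4 * L * h else 0)).
rewrite -[X in _ ^+ X]card_ord -prodr_const -big_split/=.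
apply: ler_prod => i _; rewrite sum_if_lt//; apply/andP; split.
  by rewrite !mulr_ge0// ltW.
rewrite max_r; last exact/ltW/d_gt0.
have := ler_wpM2l (ltW L0) (Nd i); rewrite -/(d i) => ?; lra.
Qed.

(** The image is bounded box by box along any cover of [A]; dividing by the positive constant first
    leaves the infimum over covers alone on its side. *)
Lemma lebesgue_outer_image (R : realType) (n : nat) (L : R)
    (f : 'rV[R]_n -> 'rV[R]_n) (A : set 'rV[R]_n) : 0 < L ->
  (forall x y, `|f x - f y| <= L * `|x - y|) ->
  (lebesgue_outer R n (f @` A) <= ((8 * L) ^+ n)%:E * lebesgue_outer R n A)%E.
Proof.
move=> L0 fL; have k0 : 0 < (8 * L) ^+ n by rewrite exprn_gt0// mulr_gt0.
rewrite -lee_pdivrMl//; apply: le_ereal_inf_tmp => _ [C [cC AC] <-].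
rewrite lee_pdivrMl//.
have cover : f @` A `<=` \bigcup_(ab in C) f @` box ab.
  by move=> _ [x /AC[ab Cab xab] <-]; exists ab => //; exists x.
apply: (le_trans (le_outer_measure _ _ _ cover)).
apply: (le_trans (outer_measure_esum _ _ cC)).
apply: (@le_trans _ _ (\esum_(ab in C) (((8 * L) ^+ n)%:E * (box_volume ab)%:E)%E)).
  by apply: le_esum => ab _; rewrite -EFinM; exact: lebesgue_outer_image_box.
(* The sum over [C] is the supremum of its finite partial sums, where the constant factors out. *)
apply: ge_ereal_sup => _ [X XC <-]; rewrite -ge0_mule_fsumr; last first.
  by move=> ab; rewrite lee_fin box_volume_ge0.
rewrite lee_pmul2l ?lte_fin//.
by apply: esum_ge; exists X.
Qed.

(** * Measurability of boxes, open sets and null sets *)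

(** Caratheodory's criterion checked on covers: the hyperplane cuts every box into two half-open
    boxes whose volumes add up, so a cover of [X] splits into covers of both parts of [X]. *)
Lemma halfspace_measurable (R : realType) (n : nat) (i : 'I_n) (c : R) :
  lebesgue_measurable [set x : 'rV[R]_n | x 0 i <= c].
Proof.
set H := [set x | _]; apply: le_caratheodory_measurable => X.
apply: le_ereal_inf_tmp => _ [C [cC XC] <-].
pose lo (ab : 'rV[R]_n * 'rV[R]_n) : 'rV[R]_n * 'rV[R]_n :=
  (ab.1, \row_j if j == i then Num.min (ab.2 0 j) c else ab.2 0 j).
pose hi (ab : 'rV[R]_n * 'rV[R]_n) : 'rV[R]_n * 'rV[R]_n :=
  (\row_j (if j == i then Num.max (ab.1 0 j) c else ab.1 0 j), ab.2).
(* Only the factor at [i] changes; the truncation at 0 in [box_volume] takes care of empty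
   pieces. *)
have split_volume ab : box_volume (lo ab) + box_volume (hi ab) = box_volume ab.
  rewrite /box_volume (bigD1 i)//= [in X in _ + X](bigD1 i)//= [RHS](bigD1 i)//=.
  rewrite !mxE eqxx (eq_bigr (fun j => Num.max 0 (ab.2 0 j - ab.1 0 j))); last first.
    by move=> j /negPf ji; rewrite mxE ji.
  rewrite [X in _ + _ * X](eq_bigr (fun j => Num.max 0 (ab.2 0 j - ab.1 0 j))); last first.
    by move=> j /negPf ji; rewrite mxE ji.
  rewrite -mulrDl; congr (_ * _); set a := ab.1 0 i; set b := ab.2 0 i.
  case: (leP b c) => bc; case: (leP a c) => ac; rewrite /Num.max;
    do ?case: ifPn; rewrite -?leNgt; lra.
have cover (J : set 'rV[R]_n) (g : _ -> 'rV[R]_n * 'rV[R]_n) :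
    (forall ab, box ab `&` J `<=` box (g ab)) ->
    (lebesgue_outer R n (X `&` J) <= \esum_(ab in C) (box_volume (g ab))%:E)%E.
  move=> gJ; apply: (@le_trans _ _ (lebesgue_outer R n (\bigcup_(ab in C) box (g ab)))).
    apply: le_outer_measure => x [/XC[ab Cab xab] Jx].
    by exists ab => //; apply: gJ.
  apply: (le_trans (outer_measure_esum _ _ cC)).
  by apply: le_esum => ab _; exact: lebesgue_outer_box.
rewrite (eq_esum (b := fun ab => ((box_volume (lo ab))%:E + (box_volume (hi ab))%:E)%E));
  last by move=> ab _; rewrite -EFinD split_volume.
rewrite esumD; try by move=> ab _; rewrite lee_fin box_volume_ge0.
apply: leeD; apply: cover => ab x [xab Hx] j; move: (xab j); rewrite !in_itv/= !mxE.
  by case: eqP => // -> /andP[-> xb]; rewrite le_min xb.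
by case: eqP => // -> /andP[ax ->]; rewrite gt_max ax ltNge; move/negP : Hx => ->.
Qed.

Lemma boxE (R : realType) (n : nat) (ab : 'rV[R]_n * 'rV[R]_n) :
  box ab = \bigcap_i (~` [set x | x 0 i <= ab.1 0 i] `&` [set x | x 0 i <= ab.2 0 i]).
Proof.
apply/seteqP; split=> x xab i.
  have := xab i; rewrite in_itv/= => /andP[ax xb] _; split=> //=.
  by apply/negP; rewrite -ltNge.
by have [/= /negP ax xb] := xab i I; rewrite in_itv/= ltNge ax.
Qed.

Lemma box_measurable (R : realType) (n : nat) (ab : 'rV[R]_n * 'rV[R]_n) :
  lebesgue_measurable (box ab).
Proof.
rewrite boxE; apply: fin_bigcap_measurable => [|i _]; first exact: finite_finset.
apply: measurableI; last exact: halfspace_measurable.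
by apply: measurableC; exact: halfspace_measurable.
Qed.

(** An open set is the union of the boxes with rational corners that it contains, and those are
    countably many. *)
Lemma open_lebesgue_measurable (R : realType) (n : nat) (U : set 'rV[R]_n) :
  open U -> lebesgue_measurable U.
Proof.
move=> oU.
pose rbox (q : 'rV[rat]_n * 'rV[rat]_n) : set 'rV[R]_n :=
  box (map_mx ratr q.1, map_mx ratr q.2).
have -> : U = \bigcup_q if `[< rbox q `<=` U >] then rbox q else set0.
  apply/seteqP; split=> [x Ux|x [q _]]; last by case: asboolP => // qU; exact: qU.
  have /nbhs_ballP[e /= e0 xeU] : nbhs x U by exact: open_nbhs_nbhs.
  have e2 : 0 < e / 2 by rewrite divr_gt0.
  have lo i : exists q : rat, ratr q \in `](x 0 i - e / 2), (x 0 i)[.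
    by apply: rat_in_itvoo; rewrite ltrBlDr ltrDl.
  have hi i : exists q : rat, ratr q \in `](x 0 i), (x 0 i + e / 2)[.
    by apply: rat_in_itvoo; rewrite ltrDl.
  have [a ha] := choice lo; have [b hb] := choice hi.
  pose q : 'rV[rat]_n * 'rV[rat]_n := (\row_i a i, \row_i b i).
  have qU : rbox q `<=` U.
    move=> y qy; apply: xeU; rewrite -ball_normE /=.
    apply: (@le_lt_trans _ _ (e / 2)); last by rewrite ltr_pdivrMr// ltr_pMr// ltr1n.
    apply: rV_norm_le => [|i]; first exact: ltW.
    have := ha i; have := hb i; have := qy i; rewrite !in_itv/= !mxE ler_norml.
    by move=> /andP[? ?] /andP[? ?] /andP[? ?]; apply/andP; split; lra.
  exists q => //; case: asboolP => // _ i.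
  have := ha i; have := hb i; rewrite !in_itv/= !mxE.
  by move=> /andP[? ?] /andP[? ?]; apply/andP; split; lra.
apply: countable_bigcupT_measurable => // q.
by case: ifP => _; [exact: box_measurable|exact: measurable0].
Qed.

Lemma closed_lebesgue_measurable (R : realType) (n : nat) (U : set 'rV[R]_n) :
  closed U -> lebesgue_measurable U.
Proof.
move=> cU; rewrite -[U]setCK; apply: measurableC.
by apply: open_lebesgue_measurable; exact: closed_openC.
Qed.

Lemma null_lebesgue_measurable (R : realType) (n : nat) (A : set 'rV[R]_n) :
  lebesgue_outer R n A = 0%E -> lebesgue_measurable A.
Proof.
move=> A0; apply: le_caratheodory_measurable => X.
rewrite [X in (X + _)%E](_ : _ = 0%E) ?add0e; first exact: le_outer_measure.
by apply/eqP; rewrite eq_le outer_measure_ge0 andbT -A0 le_outer_measure.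
Qed.

(** * Measurable sets up to null sets, and their preimages *)

(** Covers whose total volume exceeds the measure of [A] by at most [1 / (k + 1)] have unions that
    intersect in a set of the same outer measure as [A]. *)
Lemma lebesgue_measurable_hull (R : realType) (n : nat) (A : set 'rV[R]_n) :
  lebesgue_measurable A -> (lebesgue_outer R n A < +oo)%E ->
  exists C : nat -> set ('rV[R]_n * 'rV[R]_n), [/\ forall k, countable (C k),
    A `<=` \bigcap_k \bigcup_(ab in C k) box ab &
    lebesgue_outer R n ((\bigcap_k \bigcup_(ab in C k) box ab) `\` A) = 0%E].
Proof.
move=> mA Aoo.
have fA : lebesgue_outer R n A \is a fin_num.
  by rewrite ge0_fin_numE// outer_measure_ge0.
have [C hC] : {C : nat -> set ('rV[R]_n * 'rV[R]_n) & forall k,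
    box_covers A (C k) /\ (\esum_(ab in C k) (box_volume ab)%:E <=
      lebesgue_outer R n A + (k.+1%:R^-1)%:E)%E}.
  apply: (@choice _ _ (fun k C => box_covers A C /\ (\esum_(ab in C) (box_volume ab)%:E <=
      lebesgue_outer R n A + (k.+1%:R^-1)%:E)%E)) => k.
  have k0 : 0 < k.+1%:R^-1 :> R by rewrite invr_gt0.
  have [_ [C AC <-] lC] := lb_ereal_inf_adherent k0 fA.
  by exists C; split=> //; exact/ltW.
exists C; set G := \bigcap_k _.
have AG : A `<=` G by move=> x Ax k _; exact: (hC k).1.2.
split=> [k|//|]; first exact: (hC k).1.1.
have GA : (lebesgue_outer R n G <= lebesgue_outer R n A)%E.
  apply/lee_addgt0Pr => e e0.
  have [k _ ke] := near_infty_natSinv_lt (PosNum e0).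
  apply: (@le_trans _ _ (lebesgue_outer R n A + (k.+1%:R^-1)%:E)%E); last first.
    by rewrite leeD2l// lee_fin ltW//; exact: (ke k (leqnn k)).
  apply: le_trans (hC k).2; apply: (@le_trans _ _
      (lebesgue_outer R n (\bigcup_(ab in C k) box ab))).
    by apply: le_outer_measure => x; exact.
  apply: (le_trans (outer_measure_esum _ _ (hC k).1.1)).
  by apply: le_esum => ab _; exact: lebesgue_outer_box.
(* The criterion for [A] tested on [G] writes the measure of [G] as that of [A] plus that of the
   difference; the finite measure of [A] cancels. *)
have := mA G; rewrite (setIidr AG) -setDE => GE.
apply/eqP; rewrite eq_le outer_measure_ge0 andbT.
by rewrite -(leeD2lE _ _ fA) adde0 -GE.
Qed.

(** The preimage under [g] is the image under [f]. Preimages commute with set operations, so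
    continuity of [g] handles boxes, while the Lipschitz bound on [f] handles null sets. *)
Lemma lebesgue_measurable_preimage (R : realType) (n : nat) (L : R)
    (f g : 'rV[R]_n -> 'rV[R]_n) (A : set 'rV[R]_n) : 0 < L ->
  cancel f g -> cancel g f -> continuous g ->
  (forall x y, `|f x - f y| <= L * `|x - y|) ->
  lebesgue_measurable A -> lebesgue_measurable (g @^-1` A).
Proof.
move=> L0 fK gK cg fL.
have preimage_half i c : lebesgue_measurable (g @^-1` [set x | x 0 i <= c]).
  apply: closed_lebesgue_measurable; apply: closed_comp => [x _|]; first exact: cg.
  apply: (@closed_comp _ _ (fun x : 'rV[R]_n => x 0 i) [set y | y <= c]).
    by move=> x _; exact: coord_continuous.
  exact: closed_le.
have preimage_box ab : lebesgue_measurable (g @^-1` box ab).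
  rewrite boxE preimage_bigcap.
  apply: fin_bigcap_measurable => [|i _]; first exact: finite_finset.
  rewrite preimage_setI -preimage_setC.
  by apply: measurableI; [apply: measurableC|]; exact: preimage_half.
have preimage_null N : lebesgue_outer R n N = 0%E -> lebesgue_measurable (g @^-1` N).
  move=> N0; apply: null_lebesgue_measurable; apply/eqP; rewrite eq_le.
  rewrite outer_measure_ge0 andbT.
  rewrite (_ : g @^-1` N = f @` N); first by
    have := lebesgue_outer_image N L0 fL; rewrite N0 mule0.
  apply/seteqP; split=> [x Nx|_ [x Nx <-]]; last by rewrite /preimage/= fK.
  by exists (g x).
have preimage_finite B : lebesgue_measurable B -> (lebesgue_outer R n B < +oo)%E ->
    lebesgue_measurable (g @^-1` B).
  move=> mB Boo; have [C [cC BG N0]] := lebesgue_measurable_hull mB Boo.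
  set G := \bigcap_k _ in BG N0.
  rewrite (_ : B = G `\` (G `\` B)); last by rewrite setDD setIidr.
  rewrite setDE preimage_setI -preimage_setC; apply: measurableI.
    rewrite preimage_bigcap; apply: bigcap_measurableType => k _.
    rewrite preimage_bigcup; apply: countable_bigcup_measurable => [|ab _].
      exact: cC.
    exact: preimage_box.
  by apply: measurableC; exact: preimage_null.
move=> mA.
(* Cutting [A] with the cubes of half-side [k] reduces to finite measure. *)
pose D k : 'rV[R]_n * 'rV[R]_n := (const_mx (- k%:R), const_mx k%:R).
have -> : A = \bigcup_k (A `&` box (D k)).
  apply/seteqP; split=> [x Ax|x [k _ []//]].
  exists (Num.trunc `|x|).+1 => //; split=> // i.
  rewrite in_itv/= !mxE; have := rV_norm_coord x i; have := truncnS_gt `|x|.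
  by rewrite ler_norml => ? /andP[? ?]; apply/andP; split; lra.
rewrite preimage_bigcup; apply: bigcup_measurable => k _; apply: preimage_finite.
  by apply: measurableI => //; exact: box_measurable.
apply: (@le_lt_trans _ _ (box_volume (D k))%:E); last exact: ltry.
apply: le_trans (lebesgue_outer_box _).
by apply: le_outer_measure => x [].
Qed.

(** * Passage to the sup norm and conclusion *)

(** The field is Lipschitz for the Euclidean norm, while cells are measured in the sup norm;
    comparing the two costs the factor [n.+1]. *)
Lemma norm2_lipschitz (R : realType) (n : nat) (c : R)
    (f : 'rV[R]_n -> 'rV[R]_n) : 0 <= c ->
  (forall x y, norm2 (f x - f y) <= c * norm2 (x - y)) ->
  forall x y, `|f x - f y| <= n.+1%:R * c * `|x - y|.
Proof.
move=> c0 fc x y; apply: rV_norm_le => [|i]; first by rewrite !mulr_ge0.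
apply: (le_trans (norm2_coord _ i)); apply: (le_trans (fc _ _)).
rewrite -mulrA mulrCA ler_wpM2l// norm2_le_coord// => j.
exact: rV_norm_coord.
Qed.

Lemma lipschitz_continuous (R : realType) (V W : normedModType R) (L : R)
    (f : V -> W) : 0 < L ->
  (forall x y, `|f x - f y| <= L * `|x - y|) -> continuous f.
Proof.
move=> L0 fL x; apply/cvgrPdist_lt => e e0.
have Le : 0 < L^-1 * e by rewrite mulr_gt0 ?invr_gt0.
have /cvgrPdist_lt/(_ _ Le) : id @ x --> x by exact: cvg_id.
apply: filterS => y; rewrite ltr_pdivlMl//; exact/le_lt_trans.
Qed.

Theorem lemma7 (R : realType) (n : nat) (K T : R)
    (K_gt0 : 0 < K) (T_gt0 : 0 < T) (T_lt : T < 1 / K) :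
  (forall v : 'rV[R]_n -> 'rV[R]_n, unit_lipschitz_field K v ->
     forall s : R, `|s| <= T ->
       set_bij [set: 'rV[R]_n] [set: 'rV[R]_n] (shift_along v s)) /\
  (exists c C : R, [/\ 0 < c, 0 < C &
     forall v : 'rV[R]_n -> 'rV[R]_n, unit_lipschitz_field K v ->
     forall s : R, `|s| <= T ->
     forall A : set 'rV[R]_n, lebesgue_measurable A ->
       [/\ lebesgue_measurable (shift_along v s @` A),
           (c%:E * lebesgue_rV R n (shift_along v s @` A)
              <= lebesgue_rV R n A)%E &
           (lebesgue_rV R n A
              <= C%:E * lebesgue_rV R n (shift_along v s @` A))%E]]).
Proof.
have TK1 : T * K < 1 by rewrite -ltr_pdivlMr.
have TK0 : 0 < T * K by rewrite mulr_gt0.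
split=> [v vK s sT|]; first exact: (@shift_along_bij R n K T).
(* Sup-norm Lipschitz constants of the shift and of its inverse, fixed before [v] and [s], hence
   dependent only on [n], [K] and [T]. *)
pose L := n.+1%:R * (1 + T * K); pose L' := n.+1%:R * (1 - T * K)^-1.
have L0 : 0 < L by rewrite mulr_gt0// addr_gt0.
have L'0 : 0 < L' by rewrite mulr_gt0// invr_gt0 subr_gt0.
have L8 : 0 < (8 * L) ^+ n by rewrite exprn_gt0// mulr_gt0.
(* [c] comes from the image bound for the shift, [C] from the one for its inverse. *)
exists ((8 * L) ^+ n)^-1, ((8 * L') ^+ n); split=> [||v vK s sT A mA].
- by rewrite invr_gt0.
- by rewrite exprn_gt0// mulr_gt0.
set S := shift_along v s.
have [_ S_inj S_surj] : set_bij setT setT S by exact: (@shift_along_bij R n K T).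
have [g gS] : {g : 'rV[R]_n -> 'rV[R]_n & forall Y, S (g Y) = Y}.
  by apply: (@choice _ _ (fun Y X => S X = Y)) => Y; have [X _ <-] := S_surj Y I; exists X.
have Sg X : g (S X) = X by apply: S_inj; rewrite ?in_setT// gS.
have SL : forall x y, `|S x - S y| <= L * `|x - y|.
  apply: norm2_lipschitz => [|x y]; first by rewrite addr_ge0// ltW.
  exact: shift_along_lipschitz.
have gL : forall x y, `|g x - g y| <= L' * `|x - y|.
  apply: norm2_lipschitz => [|x y]; first by rewrite invr_ge0 subr_ge0 ltW.
  rewrite ler_pdivlMl ?subr_gt0//.
  have := @shift_along_expansive R n K T v s vK sT (g x) (g y).
  by rewrite -/S !gS.
have SAE : S @` A = g @^-1` A.
  apply/seteqP; split=> [_ [x Ax <-]|y Ay]; first by rewrite /preimage/= Sg.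
  by exists (g y).
split.
- rewrite SAE; apply: (lebesgue_measurable_preimage L0 Sg gS _ SL mA).
  exact: (lipschitz_continuous L'0 gL).
- by rewrite lee_pdivrMl//; exact: (lebesgue_outer_image A L0 SL).
(* [A] is the image under [g] of its shifted copy, so the image bound for [g] applies. *)
- rewrite (_ : lebesgue_rV R n A = lebesgue_outer R n (g @` (S @` A))).
    exact: (lebesgue_outer_image (S @` A) L'0 gL).
  congr (lebesgue_outer R n); apply/seteqP; split=> [x Ax|_ [_ [x Ax <-] <-]].
    by exists (S x) => //; exists x.
  by rewrite Sg.
Qed.
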